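(* Let $f(X)=a_{0}+a_{1}X+\cdots+a_{n}X^{n}\in\mathbb{Z}[X]$ with $n\ge 1$ and $a_{0}a_{n}\neq 0$, let $k\geq 2$, and let $p_{1},\dots ,p_{k}$ be pairwise distinct prime numbers. For $i=1,\dots ,k$ let $0=j_{i,1}<j_{i,2}<\cdots<j_{i,r_{i}}=n$ be the abscissae of the vertices of the Newton polygon of $f$ with respect to $p_{i}$, and for $l=1,\dots ,r_{i}-1$ let \[ m_{i,l} = \gcd\left(\nu _{p_{i}}(a_{j_{i,l+1}})-\nu _{p_{i}}(a_{j_{i,l}}),\ j_{i,l+1}-j_{i,l}\right),\qquad x_{i,l} = \frac{j_{i,l+1}-j_{i,l}}{m_{i,l}}, \] and let \[ \mathcal{S}_{p_{i}} = \left\lbrace \sum_{l=1}^{r_{i}-1} n_{i,l}x_{i,l} : n_{i,l}\in \{ 0,1,\dots , m_{i,l} \} \right\rbrace \cap \left( 0,\left\lfloor \frac{n}{2}\right\rfloor \right] . \] If $\mathcal{S}_{p_{1}}\cap\cdots \cap\mathcal{S}_{p_{k}}=\emptyset$, then $f$ is irreducible over $\mathbb{Q}$.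
   Context: For a prime $p$ and a nonzero integer $m$, $\nu_p(m)$ is the largest integer $i$ with $p^i\mid m$; $\nu_p(0)=\infty$. For $f(X)=\sum_{i=0}^n a_iX^i\in\mathbb{Z}[X]$ with $a_0a_n\neq 0$, the Newton polygon of $f$ with respect to $p$ is the lower convex hull of the points $(i,\nu_p(a_i))$, $0\le i\le n$, $a_i\neq 0$: a broken line from $(0,\nu_p(a_0))$ to $(n,\nu_p(a_n))$. Its vertices are its corner points together with its two end-points; consecutive vertices are joined by edges, and the slopes of the edges strictly increase from left to right. The greatest common divisor is taken to be positive, with $\gcd(0,m)=m$ for $m>0$. *)

(* Defs.v *)
From mathcomp Require Import all_boot all_order all_algebra.

Set Implicit Arguments.
Unset Strict Implicit.
Unset Printing Implicit Defensive.

Import Order.TTheory GRing.Theory Num.Theory.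
Local Open Scope ring_scope.

(* Since [logn p 0 = 0] (and not infinity), [nu p m] is only meaningful for
   m != 0; it is only used for nonzero coefficients below. *)
Definition nu (p : nat) (m : int) : nat := logn p `|m|%N.

(* (x, y) is a convex combination of the points (i, nu p (f`_i)), f`_i != 0.
   Rational coordinates suffice: all these points are integral. *)
Definition in_hull (p : nat) (f : {poly int}) (x y : rat) : Prop :=
  exists w : 'I_(size f) -> rat,
    [/\ forall i, 0 <= w i,
        forall i : 'I_(size f), f`_i = 0 -> w i = 0,
        \sum_i w i = 1,
        x = \sum_i w i * (i : nat)%:R
      & y = \sum_i w i * (nu p f`_i)%:R].

Definition on_newton_polygon (p : nat) (f : {poly int}) (x y : rat) : Prop :=
  in_hull p f x y /\ forall y', in_hull p f x y' -> y <= y'.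

Definition segment_pt (a b t : rat) : rat := (1 - t) * a + t * b.

(* A point of the broken line that is not interior to a nondegenerate segment
   contained in the broken line. The polygon is the graph of a function of x,
   so such a segment is never vertical. *)
Definition newton_corner (p : nat) (f : {poly int}) (x y : rat) : Prop :=
  on_newton_polygon p f x y /\
  ~ (exists x1 y1 x2 y2 t : rat,
       [/\ x1 < x2,
           0 < t < 1,
           x = segment_pt x1 x2 t,
           y = segment_pt y1 y2 t
         & forall s, 0 <= s <= 1 ->
             on_newton_polygon p f (segment_pt x1 x2 s) (segment_pt y1 y2 s)]).

Definition newton_vertex_abscissa (p : nat) (f : {poly int}) (x : rat) : Prop :=
  [\/ x = 0, x = (size f).-1%:R | exists y, newton_corner p f x y].

(* [js] is the increasing sequence of all the abscissae of the vertices. *)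
Definition newton_abscissae (p : nat) (f : {poly int}) (js : seq nat) : Prop :=
  sorted ltn js /\ forall j : nat, j \in js <-> newton_vertex_abscissa p f j%:R.

(* Edges are numbered from 0: the l-th edge joins the vertices with abscissae
   js`_l and js`_l.+1, for l < (size js).-1. *)
Definition edge_m (p : nat) (f : {poly int}) (js : seq nat) (l : nat) : nat :=
  gcdn `|(nu p f`_(nth 0%N js l.+1))%:Z - (nu p f`_(nth 0%N js l))%:Z|%N
       (nth 0%N js l.+1 - nth 0%N js l)%N.

Definition edge_x (p : nat) (f : {poly int}) (js : seq nat) (l : nat) : nat :=
  ((nth 0%N js l.+1 - nth 0%N js l) %/ edge_m p f js l)%N.

Definition degree_set (p : nat) (f : {poly int}) (js : seq nat) (s : nat) : Prop :=
  (0 < s <= (size f).-1 %/ 2)%N /\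
  exists c : nat -> nat,
    (forall l, (l < (size js).-1)%N -> (c l <= edge_m p f js l)%N) /\
    s = (\sum_(0 <= l < (size js).-1) c l * edge_x p f js l)%N.

(* Main.v *)
(** Dumas' argument.  For a rational [lam], let the [lam]-weight of the term
    a_i X^i be nu_p(a_i) - lam * i.  The first (resp. last) index of minimal
    weight is additive under multiplication of polynomials.  When [lam] is the
    slope of an edge of the Newton polygon of f = g h, these indices for f are
    the end-points of the edge, so the gap between them for f is the sum of the
    gaps for g and h; and the gap for g is a multiple of x_l, because both of
    its ends have the same weight.  Comparing consecutive slopes shows that the
    gaps for g are contiguous, so that they add up to deg g.  By Gauss' lemma a
    proper factor over the rationals yields g, h over the integers, and the one
    of smaller degree puts this degree in every degree set. *)
Require Import Defs.
From mathcomp Require Import all_boot all_order all_algebra.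
From mathcomp Require Import ring lra zify.
Import Order.TTheory GRing.Theory Num.Theory.
Local Open Scope ring_scope.

(** * Valuations of products and sums *)

Lemma dvdz_nu (p m : nat) (x : int) :
  prime p -> x != 0 -> ((p ^ m)%N%:Z %| x)%Z = (m <= nu p x)%N.
Proof. by move=> pr_p xN0; rewrite dvdzE /= pfactor_dvdn ?absz_gt0. Qed.

Lemma nuM (p : nat) (x y : int) :
  x != 0 -> y != 0 -> nu p (x * y) = (nu p x + nu p y)%N.
Proof. by move=> xN0 yN0; rewrite /nu abszM lognM ?absz_gt0. Qed.

(** The guards encode the infinite valuation of zero; divisibility by [p ^ m] absorbs that case. *)
Lemma leq_nuD (p m : nat) (x y : int) : prime p ->
    (x != 0 -> (m <= nu p x)%N) -> (y != 0 -> (m <= nu p y)%N) ->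
  x + y != 0 -> (m <= nu p (x + y))%N.
Proof.
move=> pr_p mx my xyN0; rewrite -dvdz_nu //; apply: rpredD.
  have [->|xN0] := eqVneq x 0; first exact: dvdz0.
  by rewrite dvdz_nu // mx.
have [->|yN0] := eqVneq y 0; first exact: dvdz0.
by rewrite dvdz_nu // my.
Qed.

Lemma leq_nu_sum (p m : nat) (I : Type) (r : seq I) (P : pred I) (F : I -> int) :
    prime p -> (forall i, P i -> F i != 0 -> (m <= nu p (F i))%N) ->
  \sum_(i <- r | P i) F i != 0 -> (m <= nu p (\sum_(i <- r | P i) F i))%N.
Proof.
move=> pr_p Fm; apply: (big_ind (fun x => x != 0 -> (m <= nu p x)%N)) => //.
by move=> x y; apply: leq_nuD.
Qed.

(** Divisibility by [p ^ (nu p x).+1] holds for [y] but not for [x], hence fails for the sum. *)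
Lemma nuDl (p : nat) (x y : int) : prime p -> x != 0 ->
    (y != 0 -> (nu p x < nu p y)%N) ->
  x + y != 0 /\ nu p (x + y) = nu p x.
Proof.
move=> pr_p xN0 xy.
have dy : ((p ^ (nu p x).+1)%N%:Z %| y)%Z.
  have [->|yN0] := eqVneq y 0; first exact: dvdz0.
  by rewrite dvdz_nu // xy.
have ndx : ~~ ((p ^ (nu p x).+1)%N%:Z %| x + y)%Z.
  by rewrite rpredDr // dvdz_nu // ltnn.
have xyN0 : x + y != 0 by apply: contraNneq ndx => ->; exact: dvdz0.
split=> //; apply/eqP; rewrite eqn_leq leqNgt -dvdz_nu // ndx /=.
by apply: leq_nuD => // /xy /ltnW.
Qed.

(** * Weights and their extreme minimisers *)

Definition weight (p : nat) (lam : rat) (g : {poly int}) (i : nat) : rat :=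
  (nu p g`_i)%:R - lam * i%:R.

(* The tie-breaker e = 1 selects the first index of minimal weight, e = -1 the
   last one. *)
Definition lexmin (p : nat) (e lam : rat) (g : {poly int}) (i0 : nat) : Prop :=
  g`_i0 != 0 /\ forall i, g`_i != 0 ->
    weight p lam g i0 <= weight p lam g i /\
    (weight p lam g i = weight p lam g i0 -> e * i0%:R <= e * i%:R).

Lemma lexmin_exists (p : nat) (e lam : rat) (g : {poly int}) :
  g != 0 -> exists i, lexmin p e lam g i.
Proof.
move=> gN0; have szg : (0 < size g)%N by rewrite size_poly_gt0.
pose P := [pred i : 'I_(size g) | g`_i != 0].
have ltsz i : g`_i != 0 -> (i < size g)%N.
  by rewrite ltnNge; apply: contra => /(nth_default 0)->.
have lc0 : g`_(size g).-1 != 0 by rewrite -lead_coefE lead_coef_eq0.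
have Plc : P (Ordinal (ltsz _ lc0)) by [].
case: (arg_minP (fun i : 'I_(size g) => weight p lam g i) Plc) => i Pi mini.
pose Q := [pred j : 'I_(size g) | P j && (weight p lam g j == weight p lam g i)].
have Qi : Q i by rewrite /= eqxx andbT.
case: (arg_minP (fun j : 'I_(size g) => e * j%:R) Qi) => j /andP[Pj /eqP wj] minj.
exists j; split=> // k gk; rewrite wj; split; first exact: (mini (Ordinal (ltsz _ gk))).
by move=> wk; apply: (minj (Ordinal (ltsz _ gk))); rewrite /= gk wk eqxx.
Qed.

Lemma lexmin_uniq (p : nat) (e lam : rat) (g : {poly int}) (i j : nat) :
  e != 0 -> lexmin p e lam g i -> lexmin p e lam g j -> i = j.
Proof.
move=> eN0 [gi mi] [gj mj].
have [wij eij] := mi j gj; have [wji eji] := mj i gi.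
have w : weight p lam g i = weight p lam g j by apply/eqP; rewrite eq_le wij wji.
have : e * i%:R = e * j%:R by apply/eqP; rewrite eq_le eij ?eji.
by move/(mulfI eN0)/eqP; rewrite eqr_nat => /eqP.
Qed.

(** Order indices by weight, then by [e] times the index; both are additive. At [i0 + j0] exactly
    one product has least valuation, so nothing cancels; elsewhere each product, hence also the sum,
    is no smaller in this order. *)
Lemma lexminM (p : nat) (e lam : rat) (g h : {poly int}) (i0 j0 : nat) :
    prime p -> e != 0 -> lexmin p e lam g i0 -> lexmin p e lam h j0 ->
  lexmin p e lam (g * h) (i0 + j0)%N.
Proof.
move=> pr_p eN0 [gi0 mini] [hj0 minj].
have lead : (g * h)`_(i0 + j0) != 0 /\
    nu p (g * h)`_(i0 + j0) = (nu p g`_i0 + nu p h`_j0)%N.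
  have i0P : (i0 < (i0 + j0).+1)%N by rewrite ltnS leq_addr.
  rewrite coefM (bigD1 (Ordinal i0P)) //= addKn -nuM //.
  apply: nuDl => //; first by rewrite mulf_neq0.
  apply: leq_nu_sum => // [[i /= ltik]]; rewrite -val_eqE /= => ine.
  rewrite mulf_eq0 negb_or => /andP[gi hj]; rewrite !nuM //.
  set j := (i0 + j0 - i)%N in hj *.
  have eij : (i%:R + j%:R = i0%:R + j0%:R :> rat) by rewrite -!natrD subnKC.
  rewrite -(@ltr_nat rat) !natrD.
  have [+ ei] := mini i gi; have [+ ej] := minj j hj.
  (* If strictness fails, both weights tie. As the indices have the same sum, both tie-breakers are
     then equalities, forcing the excluded [i = i0]. *)
  have [//|wle] := ltP; move: ei ej; rewrite /weight => ei ej wj wi.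
  have lij : lam * i%:R + lam * j%:R = lam * i0%:R + lam * j0%:R.
    by rewrite -!mulrDr eij.
  have exij : e * i%:R + e * j%:R = e * i0%:R + e * j0%:R by rewrite -!mulrDr eij.
  have {}ei := ei ltac:(lra); have {}ej := ej ltac:(lra).
  have /(mulfI eN0)/eqP : e * i%:R = e * i0%:R by lra.
  by rewrite eqr_nat (negPf ine).
case: lead => lead0 nulead; split=> // k.
set w0 := weight p lam (g * h) (i0 + j0).
have w0E : w0 = weight p lam g i0 + weight p lam h j0.
  by rewrite /w0 /weight nulead !natrD; ring.
(* At the fixed index [k] this is a condition on a bare valuation, closed upwards, so it passes from
   summands to sums. *)
pose P m := w0 <= m%:R - lam * k%:R /\
  (m%:R - lam * k%:R = w0 -> e * (i0 + j0)%:R <= e * k%:R).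
have terms (i : 'I_k.+1) : true ->
    g`_i * h`_(k - i) != 0 -> P (nu p (g`_i * h`_(k - i))).
  move=> _; rewrite mulf_eq0 negb_or => /andP[gi hj].
  rewrite /P nuM // w0E !natrD.
  have [wi ei] := mini i gi; have [wj ej] := minj _ hj.
  have kE : k%:R = i%:R + (k - i)%:R :> rat by rewrite -natrD subnKC // -ltnS.
  rewrite kE; move: wi wj ei ej; rewrite /weight => wi wj ei ej; split; first lra.
  move=> weq; have {}ei := ei ltac:(lra); have {}ej := ej ltac:(lra); lra.
move=> cN0; change (P (nu p (g * h)`_k)); move: cN0; rewrite coefM.
apply: (big_ind (fun x => x != 0 -> P (nu p x))) => // x y Px Py xyN0.
have up m m' : (m <= m')%N -> P m -> P m'.
  rewrite -(ler_nat rat) => lemm' [wm em]; split=> [|eqm]; first lra.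
  apply: em; lra.
have [x0|xN0] := eqVneq x 0; first by move: xyN0 Py; rewrite x0 add0r => yN0; exact.
have [y0|yN0] := eqVneq y 0; first by move: xyN0 Px; rewrite y0 addr0 => _; exact.
have [lexy|leyx] := leqP (nu p x) (nu p y).
  by apply: up (Px xN0); apply: leq_nuD.
by apply: up (Py yN0); apply: leq_nuD => // _; apply: ltnW.
Qed.

(** * Supporting lines and exposed indices *)

Definition newton_edge (p : nat) (f : {poly int}) (lam : rat) (a b : nat) : Prop :=
  [/\ (a < b)%N, lexmin p 1 lam f a & lexmin p (-1) lam f b].

(* Strict convexity at j, tested on chords so that no supporting slope has to be
   chosen. *)
Definition exposed (p : nat) (f : {poly int}) (j : nat) : Prop :=
  f`_j != 0 /\ forall a b, (a < j)%N -> (j < b)%N -> f`_a != 0 -> f`_b != 0 ->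
    (nu p f`_j)%:R * (b%:R - a%:R) <
      (nu p f`_a)%:R * (b%:R - j%:R) + (nu p f`_b)%:R * (j%:R - a%:R) :> rat.

Lemma coef_neq0_ltn_size (f : {poly int}) (i : nat) : f`_i != 0 -> (i < size f)%N.
Proof. by rewrite ltnNge; apply: contra => /(nth_default 0)->. Qed.

Lemma edge_weight (p : nat) (f : {poly int}) (lam : rat) (a b : nat) :
  newton_edge p f lam a b -> weight p lam f a = weight p lam f b.
Proof.
case=> _ [fa mina] [fb minb]; apply/eqP; rewrite eq_le.
by rewrite (mina b fb).1 (minb a fa).1.
Qed.

Lemma edge_lt_left (p : nat) (f : {poly int}) (lam : rat) (a b i : nat) :
  newton_edge p f lam a b -> f`_i != 0 -> (i < a)%N ->
  weight p lam f a < weight p lam f i.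
Proof.
case=> _ [fa mina] _ fi ia; have [wle wlt] := mina i fi.
rewrite lt_neqAle wle andbT; apply: contraTneq ia => /esym/wlt.
by rewrite !mul1r ler_nat -leqNgt.
Qed.

Lemma edge_lt_right (p : nat) (f : {poly int}) (lam : rat) (a b i : nat) :
  newton_edge p f lam a b -> f`_i != 0 -> (b < i)%N ->
  weight p lam f b < weight p lam f i.
Proof.
case=> _ _ [fb minb] fi bi; have [wle wlt] := minb i fi.
rewrite lt_neqAle wle andbT; apply: contraTneq bi => /esym/wlt.
by rewrite !mulN1r lerN2 ler_nat -leqNgt.
Qed.

(** One step of gift wrapping: the line of least slope leaving [j] supports all the points, and its
    last contact point is again exposed. *)
Lemma next_edge (p : nat) (f : {poly int}) (j : nat) :
    f != 0 -> exposed p f j -> (j < (size f).-1)%N ->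
  exists lam b, newton_edge p f lam j b /\ exposed p f b.
Proof.
move=> fN0 [fj expj] jn.
have lc0 : f`_(size f).-1 != 0 by rewrite -lead_coefE lead_coef_eq0.
pose P := [pred i : 'I_(size f) | (j < i)%N && (f`_i != 0)].
(* The least slope from j to a later point is that of the edge leaving j. *)
pose slope i : rat := ((nu p f`_i)%:R - (nu p f`_j)%:R) / (i%:R - j%:R).
have Plc : P (Ordinal (coef_neq0_ltn_size f _ lc0)) by rewrite /= jn lc0.
case: (arg_minP (fun i : 'I_(size f) => slope i) Plc) => i /andP[ji fi] mini.
set lam := slope i.
have sub_gt0 a b : (a < b)%N -> 0 < b%:R - a%:R :> rat by rewrite subr_gt0 ltr_nat.
have wi : weight p lam f i = weight p lam f j.
  have := sub_gt0 _ _ ji; rewrite /weight /lam /slope => d; field; lra.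
have right k : (j < k)%N -> f`_k != 0 -> weight p lam f j <= weight p lam f k.
  move=> jk fk; have d := sub_gt0 _ _ jk.
  have := mini (Ordinal (coef_neq0_ltn_size f _ fk)); rewrite /= jk fk => /(_ isT).
  rewrite -/lam /slope /= ler_pdivlMr // /weight; lra.
(* Convexity at [j], tested on the chord from [k] to [i], puts earlier points strictly above the
   line. *)
have left k : (k < j)%N -> f`_k != 0 -> weight p lam f j < weight p lam f k.
  move=> kj fk; have := expj k i kj ji fk fi.
  have d := sub_gt0 _ _ kj; have d' := sub_gt0 _ _ ji; move: wi; rewrite /weight => wi c.
  rewrite -subr_gt0 -(pmulr_lgt0 _ d'); nra.
have minj : lexmin p 1 lam f j.
  split=> // k fk; case: (ltngtP k j) => [kj|jk|->]; last by [].
    by have := left k kj fk; split; [lra | move=> ?; lra].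
  by split; [apply: right | move=> _; rewrite !mul1r ler_nat ltnW].
have [b minb] := lexmin_exists p (-1) lam f fN0.
have [fb lastb] := minb.
have wb : weight p lam f b = weight p lam f j.
  by apply/eqP; rewrite eq_le (lastb j fj).1 (minj.2 b fb).1.
have jb : (j < b)%N.
  have [_ ] := lastb i fi; rewrite wb => /(_ wi).
  by rewrite !mulN1r lerN2 ler_nat; apply: leq_trans.
have edge : newton_edge p f lam j b by [].
exists lam, b; split=> //; split=> // a c ab bc fa fc.
(* Points before [b] lie weakly above the line and later ones strictly; combining the two with the
   distances as coefficients gives strict convexity at [b]. *)
have wa := (lastb a fa).1; have wc := edge_lt_right _ _ _ _ _ _ edge fc bc.
have da := sub_gt0 _ _ ab; have dc := sub_gt0 _ _ bc.
move: wa wc; rewrite /weight -subr_ge0 -[_ < _]subr_gt0 => wa wc.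
have := mulr_ge0 wa (ltW dc); have := mulr_gt0 wc da; nra.
Qed.

(** * Comparison with the convex-hull definition of vertices *)

Lemma sum_two_points (m a b : nat) (s t : rat) (F : nat -> rat) :
    (a < m)%N -> (b < m)%N ->
  \sum_(i < m) (s * ((i : nat) == a)%:R + t * ((i : nat) == b)%:R) * F i =
    s * F a + t * F b.
Proof.
move=> am bm.
have pick c : (c < m)%N -> \sum_(i < m) ((i : nat) == c)%:R * F i = F c.
  move=> cm; rewrite (bigD1 (Ordinal cm)) //= eqxx mul1r big1 ?addr0 // => i.
  by rewrite -val_eqE /= => /negPf->; rewrite mul0r.
rewrite -(pick a am) -(pick b bm) !mulr_sumr -big_split /=.
by apply: eq_bigr => i _; ring.
Qed.

Lemma hull_le_degree (p : nat) (f : {poly int}) (x y : rat) :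
  in_hull p f x y -> x <= (size f).-1%:R.
Proof.
case=> w [w0 _ w1 -> _]; rewrite -[leRHS]mul1r -[X in _ <= X * _]w1 mulr_suml.
apply: ler_sum => i _; rewrite ler_wpM2l // ler_nat.
by have := ltn_ord i; case: (size f) (i : nat) => // n j; rewrite ltnS.
Qed.

(** The quantity [y - lam * x] is an average of weights. If it equals their minimum, only indices of
    minimal weight contribute, and none of these precedes [a]. *)
Lemma hull_edge_le (p : nat) (f : {poly int}) (lam : rat) (a b : nat) (x y : rat) :
  newton_edge p f lam a b -> in_hull p f x y ->
  weight p lam f a <= y - lam * x /\
  (y - lam * x = weight p lam f a -> a%:R <= x).
Proof.
move=> edge [w [w0 wf w1 -> ->]].
have sumE c : \sum_i w i * (nu p f`_i)%:R - lam * (\sum_i w i * (i : nat)%:R) - c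
    = \sum_(i < size f) w i * (weight p lam f i - c).
  rewrite -[X in _ - X]mul1r -[X in _ - X * _]w1 mulr_sumr mulr_suml -!sumrB.
  by apply: eq_bigr => i _; rewrite /weight; ring.
have ge0 (i : 'I_(size f)) : true -> 0 <= w i * (weight p lam f i - weight p lam f a).
  move=> _; have [/wf->|fi] := eqVneq f`_i 0; first by rewrite mul0r.
  by rewrite mulr_ge0 // subr_ge0; case: edge => _ [_ /(_ i fi)[]].
split; first by rewrite -subr_ge0 sumE sumr_ge0.
move/eqP; rewrite -subr_eq0 sumE => /eqP/(psumr_eq0P ge0) eq0.
rewrite -subr_ge0 -[X in _ - X]mul1r -[X in _ - X * _]w1 mulr_suml -sumrB sumr_ge0 // => i _.
have [ai|ia] := leqP a i; first by rewrite -mulrBr mulr_ge0 // subr_ge0 ler_nat.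
suff -> : w i = 0 by rewrite !mul0r subrr.
have [/wf //|fi] := eqVneq f`_i 0.
have /eqP := eq0 i isT; rewrite mulf_eq0 => /orP[/eqP //|].
have := edge_lt_left _ _ _ _ _ _ edge fi ia.
by rewrite subr_eq0 => /[swap] /eqP->; rewrite ltxx.
Qed.

Lemma edge_on_polygon (p : nat) (f : {poly int}) (lam : rat) (a b : nat) (s : rat) :
  newton_edge p f lam a b -> 0 <= s <= 1 ->
  on_newton_polygon p f (segment_pt a%:R b%:R s)
    (segment_pt (nu p f`_a)%:R (nu p f`_b)%:R s).
Proof.
move=> edge /andP[s0 s1]; have [ab [fa _] [fb _]] := edge.
have am := coef_neq0_ltn_size _ _ fa; have bm := coef_neq0_ltn_size _ _ fb.
split; last first.
  move=> y hull; have [+ _] := hull_edge_le _ _ _ _ _ _ _ edge hull.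
  have := congr1 ( *%R s) (edge_weight _ _ _ _ _ edge).
  by rewrite /weight /segment_pt => ? ?; lra.
pose w (i : 'I_(size f)) : rat :=
  (1 - s) * ((i : nat) == a)%:R + s * ((i : nat) == b)%:R.
exists w; split; rewrite /w.
- by move=> i; rewrite addr_ge0 // mulr_ge0 // ?subr_ge0 // ler0n.
- move=> i fi; have [ia|_] := eqVneq (i : nat) a; first by rewrite -ia fi eqxx in fa.
  have [ib|_] := eqVneq (i : nat) b; first by rewrite -ib fi eqxx in fb.
  by rewrite !mulr0 addr0.
- have := sum_two_points _ _ _ (1 - s) s (fun=> 1) am bm.
  under eq_bigr do rewrite mulr1.
  by move=> ->; ring.
- by rewrite (sum_two_points _ _ _ _ _ (fun i => i%:R) am bm).
- by rewrite (sum_two_points _ _ _ _ _ (fun i => (nu p f`_i)%:R) am bm).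
Qed.

(** Unless [j] is the last index, an edge leaves it. On a segment through [j] inside the polygon,
    [y - lam * x] would be minimal at the left end too, so that end could not lie left of [j]. *)
Lemma exposed_vertex (p : nat) (f : {poly int}) (j : nat) :
  exposed p f j -> newton_vertex_abscissa p f j%:R.
Proof.
move=> expj; have [fj _] := expj.
have fN0 : f != 0 by apply: contraNneq fj => ->; rewrite coef0.
have := coef_neq0_ltn_size _ _ fj; rewrite -[X in (_ < X)%N]prednK ?size_poly_gt0 // ltnS.
rewrite leq_eqVlt => /orP[/eqP-> | jn]; first exact: Or32.
have [lam [b [edge _]]] := next_edge p f j fN0 expj jn.
apply: Or33; exists (nu p f`_j)%:R; split.
  have := edge_on_polygon _ _ _ _ _ 0 edge; rewrite lexx ler01 => /(_ isT).
  by rewrite /segment_pt !subr0 !mul1r !mul0r !addr0.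
case=> x1 [y1 [x2 [y2 [t [x12 /andP[t0 t1] xE yE seg]]]]].
have := (seg 0 ltac:(lra)).1; rewrite /segment_pt !subr0 !mul1r !mul0r !addr0.
move/(hull_edge_le _ _ _ _ _ _ _ edge) => [ge1 eq1].
have := (seg 1 ltac:(lra)).1; rewrite /segment_pt !subrr !mul1r !mul0r !add0r.
move/(hull_edge_le _ _ _ _ _ _ _ edge) => [ge2 _].
move: ge1 ge2 eq1 xE yE; rewrite /weight /segment_pt => ge1 ge2 eq1 xE yE.
have t1' : 0 < 1 - t by lra.
have jx1 : j%:R <= x1.
  apply: eq1; apply/eqP; rewrite eq_le ge1 andbT -(ler_pM2l t1').
  have avg : (nu p f`_j)%:R - lam * j%:R = (1 - t) * (y1 - lam * x1) + t * (y2 - lam * x2).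
    by rewrite xE yE; ring.
  have := ler_wpM2l (ltW t0) ge2; lra.
have tx : t * x1 < t * x2 by rewrite ltr_pM2l.
lra.
Qed.

(** The edges obtained by walking from index 0 cover every index up to the degree. *)
Lemma exposed_or_edge (p : nat) (f : {poly int}) (j : nat) :
    f`_0 != 0 -> (j <= (size f).-1)%N ->
  exposed p f j \/
  exists a b lam, [/\ newton_edge p f lam a b, (a < j)%N & (j < b)%N].
Proof.
move=> f0; have fN0 : f != 0 by apply: contraNneq f0 => ->; rewrite coef0.
have reach a b lam : newton_edge p f lam a b -> exposed p f b -> (a < j)%N -> (j <= b)%N ->
  exposed p f j \/ exists a b lam, [/\ newton_edge p f lam a b, (a < j)%N & (j < b)%N].
  move=> edge expb aj; rewrite leq_eqVlt => /orP[/eqP-> | jb]; first by left.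
  by right; exists a, b, lam.
(* For the induction, the edge may end at [j] itself, and its right end is exposed so that the walk
   can go on. *)
move=> jn; suff [expj | [a [b [lam [edge expb aj jb]]]]] :
    exposed p f j \/ exists a b lam, [/\ newton_edge p f lam a b, exposed p f b,
      (a < j)%N & (j <= b)%N] by [left | exact: reach edge expb aj jb].
elim: j jn {reach} => [_|j IH jn]; first by left; split=> // a b.
right; have [expj | [a [b [lam [edge expb aj]]]]] := IH (ltnW jn).
  by have [lam [b [edge expb]]] := next_edge p f j fN0 expj jn;
    exists j, b, lam; split=> //; case: edge.
rewrite leq_eqVlt => /orP[/eqP jb | jb]; last by exists a, b, lam; split=> //; apply: ltnW.
rewrite -jb in expb; have [lam' [b' [edge' expb']]] := next_edge p f j fN0 expb jn.
by exists j, b', lam'; split=> //; case: edge'.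
Qed.

(** The end indices have no chord around them. A corner strictly inside the span of an edge would be
    interior to a segment of the polygon, as its height is the minimal one. *)
Lemma vertex_exposed (p : nat) (f : {poly int}) (j : nat) :
  f`_0 != 0 -> newton_vertex_abscissa p f j%:R -> exposed p f j.
Proof.
move=> f0; have fN0 : f != 0 by apply: contraNneq f0 => ->; rewrite coef0.
case=> [/eqP|/eqP|[y [onp nseg]]].
- by rewrite pnatr_eq0 => /eqP->; split=> // a b.
- rewrite eqr_nat => /eqP->; split; first by rewrite -lead_coefE lead_coef_eq0.
  by move=> a b _ nb _ /(coef_neq0_ltn_size _ _); lia.
have jn : (j <= (size f).-1)%N.
  by have := hull_le_degree _ _ _ _ onp.1; rewrite ler_nat.
have [//|[a [b [lam [edge aj jb]]]]] := exposed_or_edge p f j f0 jn.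
have aj' : a%:R < j%:R :> rat by rewrite ltr_nat.
have jb' : j%:R < b%:R :> rat by rewrite ltr_nat.
pose t : rat := (j%:R - a%:R) / (b%:R - a%:R).
have t01 : 0 < t < 1.
  by rewrite divr_gt0 ?subr_gt0 ?ltr_pdivrMr ?mul1r; lra.
have jE : j%:R = segment_pt a%:R b%:R t.
  by rewrite /segment_pt /t; field; lra.
have [hull min] := edge_on_polygon _ _ _ _ _ t edge ltac:(lra).
rewrite -jE in hull min.
case: nseg; exists a%:R, (nu p f`_a)%:R, b%:R, (nu p f`_b)%:R, t; split=> //.
- lra.
- by apply/eqP; rewrite eq_le (onp.2 _ hull) (min _ onp.1).
- by move=> s s01; apply: edge_on_polygon edge s01.
Qed.

(** Strict convexity tested on the chord from [a] to [b] would give [j] a weight below the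
    minimum. *)
Lemma edge_not_exposed (p : nat) (f : {poly int}) (lam : rat) (a b j : nat) :
  newton_edge p f lam a b -> (a < j)%N -> (j < b)%N -> ~ exposed p f j.
Proof.
move=> edge aj jb [fj expj]; have [ab [fa mina] [fb _]] := edge.
have := expj _ _ aj jb fa fb; have ab0 : 0 < b%:R - a%:R :> rat by rewrite subr_gt0 ltr_nat.
have := edge_weight _ _ _ _ _ edge => /(congr1 ( *%R (j%:R - a%:R))).
have := ler_wpM2l (ltW ab0) (mina j fj).1.
rewrite /weight; lra.
Qed.

(** The edge leaving a listed vertex ends at an exposed index [c], which is listed as well. It
    cannot pass the next listed vertex, which is exposed, nor stop before it, since [js] is
    sorted. *)
Lemma abscissae_edge (p : nat) (f : {poly int}) (js : seq nat) (l : nat) :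
    f`_0 != 0 -> newton_abscissae p f js -> (l < (size js).-1)%N ->
  exists lam, newton_edge p f lam (nth 0%N js l) (nth 0%N js l.+1).
Proof.
move=> f0 [srt mem] ll.
have fN0 : f != 0 by apply: contraNneq f0 => ->; rewrite coef0.
have l1 : (l.+1 < size js)%N by lia.
have exp i : (i < size js)%N -> exposed p f (nth 0%N js i).
  by move=> il; apply: vertex_exposed => //; apply/mem/mem_nth.
have lt := sorted_ltn_nth ltn_trans 0%N srt.
have a_b : (nth 0%N js l < nth 0%N js l.+1)%N by apply: lt; rewrite ?inE ?(ltnW l1).
have expa := exp l (ltnW l1); have expb := exp _ l1.
have an : (nth 0%N js l < (size f).-1)%N.
  by have := coef_neq0_ltn_size _ _ expb.1; lia.
have [lam [c [edge expc]]] := next_edge p f _ fN0 expa an.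
exists lam; suff -> : nth 0%N js l.+1 = c by [].
have cjs : c \in js by apply/mem/exposed_vertex.
have [ac _ [fc _]] := edge.
case: (ltngtP (nth 0%N js l.+1) c) => // [bc | cb].
  by case: (edge_not_exposed _ _ _ _ _ _ edge a_b bc expb).
have ic : (index c js < size js)%N by rewrite index_mem.
have cE : nth 0%N js (index c js) = c by rewrite nth_index.
have [lei|ltl] := leqP (index c js) l; last first.
  move: ltl; rewrite leq_eqVlt => /orP[/eqP lE | /lt].
    by move: cb; rewrite lE cE ltnn.
  by rewrite !inE => /(_ l1 ic); rewrite cE => /(ltn_trans cb); rewrite ltnn.
move: lei; rewrite leq_eqVlt => /orP[/eqP lE | /lt].
  by move: ac; rewrite -lE cE ltnn.
by rewrite !inE => /(_ ic (ltnW l1)); rewrite cE => /(ltn_trans ac); rewrite ltnn.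
Qed.

(** * Comparison of slopes, and divisibility along an edge *)

(** The index [c] lies strictly above the line of the first edge, and on the line of slope [mu]
    through [b]. *)
Lemma edge_slope_lt (p : nat) (f : {poly int}) (lam mu : rat) (a b c : nat) :
  newton_edge p f lam a b -> newton_edge p f mu b c -> lam < mu.
Proof.
move=> edge edge'; have [bc _ [fc _]] := edge'.
have := edge_lt_right _ _ _ _ _ _ edge fc bc; have := edge_weight _ _ _ _ _ edge'.
rewrite /weight => eqw ltw; rewrite -subr_gt0.
have bc0 : 0 < c%:R - b%:R :> rat by rewrite subr_gt0 ltr_nat.
rewrite -(pmulr_lgt0 _ bc0); lra.
Qed.

(** Adding the two minimality inequalities cancels the valuations and leaves
    [0 <= (mu - lam) * (a - b)]. *)
Lemma lexmin_slope_leq (p : nat) (e e' lam mu : rat) (g : {poly int}) (a b : nat) :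
  lam < mu -> lexmin p e lam g b -> lexmin p e' mu g a -> (b <= a)%N.
Proof.
move=> ltlm [gb minb] [ga mina]; have lm0 : 0 < mu - lam by rewrite subr_gt0.
have := (minb a ga).1; have := (mina b gb).1; rewrite /weight => wa wb.
rewrite -(ler_nat rat) -subr_ge0 -(pmulr_rge0 _ lm0); lra.
Qed.

Lemma dvdn_divgcd (k m d : nat) :
  (0 < d)%N -> (d %| m * k)%N -> (d %/ gcdn m d %| k)%N.
Proof.
move=> d0; have c0 : (0 < gcdn m d)%N by rewrite gcdn_gt0 d0 orbT.
have [/divnK mE /divnK dE] := (dvdn_gcdl m d, dvdn_gcdr m d).
have coxy : coprime (d %/ gcdn m d) (m %/ gcdn m d).
  by rewrite /coprime -(eqn_pmul2r c0) mul1n muln_gcdl mE dE gcdnC.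
move=> dvd_mk; rewrite -(Gauss_dvdr _ coxy) -(dvdn_pmul2r c0).
by rewrite dE mulnAC mE.
Qed.

(** Both gaps have slope [lam]; cross-multiplying shows that [j' - j] divides the edge's height
    difference times [b - a], and the gcd can be cancelled. *)
Lemma edge_step_dvd (p : nat) (f g : {poly int}) (lam : rat) (j j' a b : nat) :
    newton_edge p f lam j j' -> (a <= b)%N ->
    weight p lam g a = weight p lam g b ->
  ((j' - j) %/ gcdn `|(nu p f`_j')%:Z - (nu p f`_j)%:Z| (j' - j) %| b - a)%N.
Proof.
move=> edge ab; have [jj' _ _] := edge; have := edge_weight _ _ _ _ _ edge.
rewrite /weight => wf wg; apply: dvdn_divgcd; first by rewrite subn_gt0.
set N := (nu p f`_j')%:Z - _.
suff /(congr1 absz) : N * (b - a)%N%:Z =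
    ((nu p g`_b)%:Z - (nu p g`_a)%:Z) * (j' - j)%N%:Z.
  by rewrite !abszM !absz_nat => ->; apply: dvdn_mull.
apply: (intr_inj (R := rat)); rewrite !rmorphM /= /N -!subzn ?(ltnW jj') //.
rewrite !rmorphB /= -!pmulrn.
have -> : (nu p f`_j')%:R - (nu p f`_j)%:R = lam * (j'%:R - j%:R) by lra.
have -> : (nu p g`_b)%:R - (nu p g`_a)%:R = lam * (b%:R - a%:R) by lra.
ring.
Qed.

(** * Degrees of integral factors *)

Lemma abscissae_first (p : nat) (f : {poly int}) (js : seq nat) :
  newton_abscissae p f js -> nth 0%N js 0 = 0%N.
Proof.
case=> srt mem; have mem0 : 0%N \in js by apply/mem; apply: Or31.
have := sorted_leq_nth leq_trans leqnn 0%N (sub_sorted ltnW srt) 0%N (index 0%N js).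
rewrite !inE index_mem mem0 nth_index // => /(_ _ isT isT) le0.
by apply/eqP; rewrite -leqn0 le0 //; case: (js) mem0.
Qed.

Lemma abscissae_last (p : nat) (f : {poly int}) (js : seq nat) :
  f`_0 != 0 -> newton_abscissae p f js -> nth 0%N js (size js).-1 = (size f).-1.
Proof.
move=> f0 [srt mem]; have memn : (size f).-1 \in js by apply/mem; apply: Or32.
have js0 : (0 < size js)%N by case: (js) memn.
have last_js : ((size js).-1 < size js)%N by rewrite prednK.
apply/eqP; rewrite eqn_leq; apply/andP; split.
  have /mem/(vertex_exposed _ _ _ f0)[+ _] := mem_nth 0%N last_js.
  by move/(coef_neq0_ltn_size _ _) => ltn; rewrite -ltnS (ltn_predK ltn).
have := sorted_leq_nth leq_trans leqnn 0%N (sub_sorted ltnW srt)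
  (index (size f).-1 js) (size js).-1.
rewrite !inE index_mem memn last_js nth_index // => -> //.
by rewrite -ltnS prednK // index_mem.
Qed.

Lemma factor_degree (p : nat) (g h : {poly int}) (js : seq nat) :
    prime p -> (g * h)`_0 != 0 -> newton_abscissae p (g * h) js ->
  exists c : nat -> nat,
    (forall l, (l < (size js).-1)%N -> (c l <= edge_m p (g * h) js l)%N) /\
    (size g).-1 = (\sum_(0 <= l < (size js).-1) c l * edge_x p (g * h) js l)%N.
Proof.
move=> pr_p gh0 absc; set f := g * h in gh0 absc *.
have fN0 : f != 0 by apply: contraNneq gh0 => ->; rewrite coef0.
have [gN0 hN0] : g != 0 /\ h != 0 by apply/andP; rewrite -negb_or -mulf_eq0.
have [g0 h0] : g`_0 != 0 /\ h`_0 != 0.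
  by apply/andP; rewrite -negb_or -mulf_eq0 -coef0M.
pose J l := nth 0%N js l.
(* Invariant after some edges: [b] and [d] are the gaps accumulated in [g] and [h]. The last clause
   says that on the next edge neither factor has its first minimiser before these. *)
suff [c [b [d [bnd sumE bd [gb hd] _]]]] : exists c b d,
    [/\ forall l, (l < (size js).-1)%N -> (c l <= edge_m p f js l)%N,
        b = (\sum_(0 <= l < (size js).-1) c l * edge_x p f js l)%N,
        (b + d = J (size js).-1)%N, g`_b != 0 /\ h`_d != 0 &
        forall mu k, newton_edge p f mu (J (size js).-1) k -> forall i,
          (lexmin p 1 mu g i -> (b <= i)%N) /\ (lexmin p 1 mu h i -> (d <= i)%N)].
  (* At the last vertex [b] and [d] are at most the degrees of [g] and [h] and have the same sum, so
     [b] is the degree of [g]. *)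
  exists c; split=> //; rewrite -sumE.
  have bg : (b < size g)%N := coef_neq0_ltn_size _ _ gb.
  have dh : (d < size h)%N := coef_neq0_ltn_size _ _ hd.
  have : (b + d = (size g + size h).-1.-1)%N.
    by rewrite bd /J (abscissae_last _ _ _ gh0 absc) size_mul.
  lia.
elim: {-2}(size js).-1 (leqnn (size js).-1) => [_|l IH ltl].
  exists (fun=> 0%N), 0%N, 0%N; split=> //; first by rewrite big_geq.
  by rewrite /J (abscissae_first _ _ _ absc).
have [c [b [d [bnd sumE bd _ next]]]] := IH (ltnW ltl).
have [lam edge] := abscissae_edge _ _ _ _ gh0 absc ltl.
have oneN0 : 1 != 0 :> rat by []. have N1N0 : -1 != 0 :> rat by [].
have [a mina] := lexmin_exists p 1 lam g gN0.
have [a' mina'] := lexmin_exists p 1 lam h hN0.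
have [b' minb] := lexmin_exists p (-1) lam g gN0.
have [d' mind] := lexmin_exists p (-1) lam h hN0.
have [ltJ firstJ lastJ] := edge.
have aE : (a + a' = J l)%N.
  by apply: lexmin_uniq firstJ; last exact: lexminM mina mina'.
have bE : (b' + d' = J l.+1)%N.
  by apply: lexmin_uniq lastJ; last exact: lexminM minb mind.
(* Contiguity: both first minimisers are at least [b] and [d], yet their sum is [b + d]. *)
have ba := (next _ _ edge a).1 mina; have da := (next _ _ edge a').2 mina'.
have {ba da bd} ab : a = b by lia.
subst a.
have first_le_last q i i' : lexmin p 1 lam q i -> lexmin p (-1) lam q i' ->
    (i <= i')%N /\ weight p lam q i = weight p lam q i'.
  move=> [qi mini] [qi' mini'].
  have w : weight p lam q i = weight p lam q i'.
    by apply/eqP; rewrite eq_le (mini i' qi').1 (mini' i qi).1.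
  by split=> //; have := (mini i' qi').2 (esym w); rewrite !mul1r ler_nat.
have [bb' wb] := first_le_last _ _ _ mina minb.
have [ad' _] := first_le_last _ _ _ mina' mind.
have xd := edge_step_dvd _ _ _ _ _ _ _ _ edge bb' wb.
have m0 : (0 < edge_m p f js l)%N by rewrite gcdn_gt0 subn_gt0 ltJ orbT.
have x0 : (0 < edge_x p f js l)%N.
  by rewrite divn_gt0 // dvdn_leq ?subn_gt0 // dvdn_gcdr.
pose u := ((b' - b) %/ edge_x p f js l)%N.
have uE : (u * edge_x p f js l = b' - b)%N by rewrite divnK.
exists (fun i => if i == l then u else c i), b', d'; split=> //.
- move=> i; rewrite ltnS leq_eqVlt; case: eqP => [-> _ | _ /= il]; last exact: bnd.
  (* Multiplied by the step, the bound says that the gap of [g] is at most that of the product; the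
     gap of [h] makes up the rest. *)
  rewrite -(leq_pmul2r x0) uE mulnC divnK ?dvdn_gcdr //.
  move: aE bE; rewrite /J; lia.
- rewrite big_nat_recr //= eqxx uE.
  rewrite (_ : \sum_(0 <= i < l) _ = b)%N ?subnKC // sumE.
  by apply: eq_big_nat => i /andP[_ il]; rewrite ltn_eqF.
- by split; [case: minb | case: mind].
- move=> mu k /(edge_slope_lt _ _ _ _ _ _ _ edge) ltm i.
  by split; [apply: lexmin_slope_leq ltm minb | apply: lexmin_slope_leq ltm mind].
Qed.

Theorem theoremA (n : nat) (f : {poly int}) (k : nat)
    (p : 'I_k -> nat) (js : 'I_k -> seq nat) :
  (1 <= n)%N -> size f = n.+1 -> f`_0 != 0 ->
  (2 <= k)%N -> injective p -> (forall i, prime (p i)) ->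
  (forall i, newton_abscissae (p i) f (js i)) ->
  ~ (exists s : nat, forall i, degree_set (p i) f (js i) s) ->
  irreducible_poly (map_poly (intr : int -> rat) f).
Proof.
move=> n1 szf f0 _ _ pr_p absc nodeg.
have fN0 : f != 0 by rewrite -size_poly_gt0 szf.
have nofactor (g h : {poly int}) :
    f = g * h -> (1 < size g)%N -> ((size g).-1 <= n %/ 2)%N -> False.
  move=> fE g1 gn; apply: nodeg; exists (size g).-1 => i; split.
    by rewrite szf gn andbT; lia.
  by move: f0 (absc i); rewrite fE => f0 /(factor_degree _ _ _ _ (pr_p i) f0).
(* Otherwise both factors are nonconstant, and one of them has degree at most [n %/ 2]. *)
have size_factor (g h : {poly int}) : f = g * h -> size g != 1 -> size g = size f.
  move=> fE gN1.
  have [gN0 hN0] : g != 0 /\ h != 0 by apply/andP; rewrite -negb_or -mulf_eq0 -fE.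
  have szgh : n.+1 = (size g + size h).-1 by rewrite -szf fE size_mul.
  have szg : (0 < size g)%N by rewrite size_poly_gt0.
  have szh : (0 < size h)%N by rewrite size_poly_gt0.
  have g1 : (1 < size g)%N by lia.
  have [/(nofactor g h fE g1) //|ltg] := leqP (size g).-1 (n %/ 2).
  have [h1|h1] := ltnP 1 (size h); last by rewrite szf; lia.
  by case: (nofactor h g _ h1); [rewrite mulrC | lia].
split=> [|q qN1 qdvd]; first by rewrite size_map_inj_poly ?szf //; apply: intr_inj.
(* Gauss' lemma: a rational divisor is a scalar multiple of an integral factor. *)
rewrite -dvdp_size_eqp //; have [g [a aN0 qE] [h fE]] := dvdpP_rat_int qdvd.
move: qN1; rewrite qE size_scale // !size_rat_int_poly => gN1.
by apply/eqP/(size_factor g h).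
Qed.
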